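(* Let $G$ be a countable amenable group, $\mathbb{K}$ a field, and $V$ a finite-dimensional vector space over $\mathbb{K}$. Then every strongly irreducible linear subshift $X \subset V^G$ is L-surjunctive.
   Context: For a group $G$ and a set $A$, $A^G$ is the set of all maps (configurations) $x \colon G \to A$, equipped with the prodiscrete topology (the product topology obtained from the discrete topology on each factor $A$) and with the left $G$-action $(gx)(h) = x(g^{-1}h)$. A subshift is a closed $G$-invariant subset $X \subset A^G$. For $\Omega \subset G$, $x\vert_\Omega$ denotes restriction. Strong irreducibility: for a finite subset $\Delta \subset G$, a subshift $X \subset A^G$ is $\Delta$-irreducible if, whenever $\Omega_1,\Omega_2$ are finite subsets of $G$ such that there is no $g \in \Omega_2$ with $g\Delta \cap \Omega_1 \neq \varnothing$, then for all $x_1,x_2 \in X$ there is $x \in X$ with $x\vert_{\Omega_1} = x_1\vert_{\Omega_1}$ and $x\vert_{\Omega_2} = x_2\vert_{\Omega_2}$. $X$ is strongly irreducible if it is $\Delta$-irreducible for some finite $\Delta \subset G$. Cellular automata: a map $\tau \colon X \to Y$ between subshifts $X,Y \subset A^G$ is a cellular automaton if there are a finite subset $M \subset G$ and a map $\mu \colon A^M \to A$ with $\tau(x)(g) = \mu((g^{-1}x)\vert_M)$ for all $x \in X$, $g \in G$. Linear setting: if $V$ is a vector space over $\mathbb{K}$, $V^G$ has its product vector space structure; a linear subshift is a subshift $X \subset V^G$ that is a vector subspace of $V^G$, and a linear cellular automaton between linear subshifts is a cellular automaton that is a $\mathbb{K}$-linear map. A linear subshift $X \subset V^G$ is L-surjunctive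 if every injective linear cellular automaton $\tau \colon X \to X$ is surjective. *)

(* Defs.v *)
From HB Require Import structures.
From mathcomp Require Import all_boot all_order all_algebra.
From mathcomp Require Import all_classical all_reals all_analysis.

Set Implicit Arguments.
Unset Strict Implicit.
Unset Printing Implicit Defensive.

Import GRing.Theory.
Local Open Scope classical_set_scope.
Local Open Scope ring_scope.

(* Amenability in von Neumann's sense: there is a left-invariant finitely
   additive probability measure defined on all subsets of G. *)
Definition invariant_mean (R : realType) (G : groupType) (m : set G -> R) :=
  [/\ forall E : set G, 0 <= m E,
      m [set: G] = 1,
      forall E F : set G, E `&` F = set0 -> m (E `|` F) = m E + m F
    & forall (g : G) (E : set G), m [set (g * h)%g | h in E] = m E].

Definition amenable (R : realType) (G : groupType) :=
  exists m : set G -> R, invariant_mean m.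

Section Subshifts.
Context {G : groupType} {A : choiceType}.
Implicit Types (X Y : set (G -> A)) (x : G -> A).

Definition shift (g : G) x : G -> A := fun h => x (g^-1 * h)%g.

Definition prodiscrete_closed X :=
  closed (X : set {ptws G -> discrete_topology A}).

Definition subshift X :=
  prodiscrete_closed X /\ forall g : G, shift g @` X `<=` X.

Definition irreducible (Delta : set G) X :=
  forall Omega1 Omega2 : set G, finite_set Omega1 -> finite_set Omega2 ->
    ~ (exists2 g, Omega2 g &
         [set (g * d)%g | d in Delta] `&` Omega1 !=set0) ->
    forall x1 x2, X x1 -> X x2 ->
      exists x, [/\ X x, {in Omega1, x =1 x1} & {in Omega2, x =1 x2}].

Definition strongly_irreducible X :=
  exists2 Delta : set G, finite_set Delta & irreducible Delta X.

(* A map X -> Y is represented by a total function tau sending X into Y; the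
   values of tau outside X are never constrained.  sigL M x is the restriction
   of x to M. *)
Definition cellular_automaton X Y (tau : (G -> A) -> (G -> A)) :=
  set_fun X Y tau /\
  exists2 M : set G, finite_set M &
    exists mu : (M -> A) -> A,
      forall x, X x -> forall g : G, tau x g = mu (sigL M (shift g^-1%g x)).

End Subshifts.

Section LinearSubshifts.
Context {G : groupType} {K : fieldType} {V : vectType K}.
Implicit Types X Y : set (G -> V).

Definition linear_subshift X :=
  subshift X /\ submod_closed (mem X).

Definition linear_cellular_automaton X Y (tau : (G -> V) -> (G -> V)) :=
  cellular_automaton X Y tau /\
  forall a : K, {in X &, forall x y, tau (a *: x + y) = a *: tau x + tau y}.

Definition L_surjunctive X :=
  forall tau, linear_cellular_automaton X X tau ->
    set_inj X tau -> set_surj X X tau.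

End LinearSubshifts.

(* Main.v *)
Require Import Defs.
From HB Require Import structures.
From mathcomp Require Import all_boot all_order all_algebra.
From mathcomp Require Import finmap zify.
From mathcomp Require Import all_classical all_reals all_analysis.

(** The argument is the Myhill half of the Garden of Eden theorem, carried out
    with dimensions of spaces of finitely supported configurations.

    Suppose that [tau] is injective on [X] and misses a configuration [y] of
    [X].  Since [V] is finite-dimensional, closed affine sets of configurations
    behave as in a compact space ([local_conditions_compactness]).  This gives
    two things.  The image of [tau] is closed, so [y] already differs from
    every element of the image on some fixed finite set [s].  Also, strong
    irreducibility yields a [z] in [X] with finite support [S] that agrees with
    [y] on [s].

    For a finite [F], let [X_F] be the space of elements of [X] supported in
    [F].  Take a finite set [F0] and a large subset [T] of [F0] such that the
    translates [t S], for [t] in [T], are disjoint ([disjoint_translates]).  The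
    configurations [t z] are linearly independent modulo the image of [tau]
    ([translates_independent]).  With [F = F0 S] and with [F'] a bounded
    enlargement of [F] containing the supports of the images of [X_F], the
    injectivity of [tau] gives [\dim X_F + #|T| <= \dim X_F'].  On the other
    hand [\dim X_F'] exceeds [\dim X_F] by at most [dim V] times the number of
    points of [F'] outside [F].  So that number is at least a fixed positive
    fraction of the cardinal of [F0], for every [F0].  This contradicts
    amenability in Følner's form.

    Følner's form is derived from an invariant mean by Tarski's argument
    ([amenable_folner]): if all finite sets expanded under right multiplication
    by a fixed finite set, the marriage theorem would produce an injection from
    [p + 1] copies of [G] into [p] copies which moves points only by that
    finite set, and an invariant mean forbids it. *)

Set Implicit Arguments.
Unset Strict Implicit.
Unset Printing Implicit Defensive.

Import Order.TTheory GRing.Theory Num.Theory.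
Local Open Scope classical_set_scope.

(** * Enumerations *)

Lemma countable_enumeration (T : Type) (t0 : T) : countable [set: T] ->
  exists (e : nat -> T) (idx : T -> nat), cancel idx e.
Proof.
move=> /countable_injP[f injf].
exists (fun n => if pselect (exists t, f t = n) is left ex then sval (cid ex)
                 else t0), f => t.
case: pselect => [ex|[]]; last by exists t.
by apply: injf; rewrite ?in_setT // (svalP (cid ex)).
Qed.

(** * The marriage theorem for countably many finite sets *)

Section Hall.
Context {I J : choiceType}.
Implicit Types (N : I -> {fset J}) (P Q : {fset I}).

Definition neighbours N P : {fset J} := (\bigcup_(i <- P) N i)%fset.

Definition hall N := forall P, (#|` P| <= #|` neighbours N P|)%N.

Definition assign N (i : I) (y : J) : I -> {fset J} :=
  fun k => if k == i then [fset y]%fset else N k.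

Lemma neighboursP N P y :
  reflect (exists2 i, i \in P & y \in N i) (y \in neighbours N P).
Proof.
apply: (iffP (bigfcupP _ _ _ _)) => -[i].
  by rewrite andbT => iP yN; exists i.
by move=> iP yN; exists i; rewrite ?andbT.
Qed.

Lemma neighboursU N P Q :
  neighbours N (P `|` Q)%fset = (neighbours N P `|` neighbours N Q)%fset.
Proof.
apply/fsetP => y; rewrite inE; apply/neighboursP/orP.
  case=> i; rewrite inE => /orP[] iP yN; [left|right];
    by apply/neighboursP; exists i.
by case=> /neighboursP[i iP yN]; exists i; rewrite // inE iP ?orbT.
Qed.

Lemma neighboursI_sub N P Q : (neighbours N (P `&` Q) `<=`
  neighbours N P `&` neighbours N Q)%fset.
Proof.
apply/fsubsetP => y /neighboursP[i]; rewrite inE => /andP[iP iQ] yN.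
by rewrite inE; apply/andP; split; apply/neighboursP; exists i.
Qed.

(** Submodularity of the number of neighbours: the finite sets of indices for
    which Hall's condition is an equality are stable under union. *)
Lemma hall_tightU N P Q : hall N ->
  (#|` neighbours N P| <= #|` P|)%N -> (#|` neighbours N Q| <= #|` Q|)%N ->
  (#|` neighbours N (P `|` Q)%fset| <= #|` (P `|` Q)%fset|)%N.
Proof.
move=> hN tP tQ.
have := cardfsUI P Q.
have := cardfsUI (neighbours N P) (neighbours N Q); rewrite -neighboursU.
have := fsubset_leq_card (neighboursI_sub N P Q).
have := hN (P `&` Q)%fset.
move: tP tQ; lia.
Qed.

(** If no assignment to [i] preserved Hall's condition, then each [y] in [N i]
    would be a neighbour of a tight set of indices avoiding [i].  The union [P]
    of these sets is tight and has all of [N i] among its neighbours, so Hall's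
    condition would fail for [P] with [i] added. *)
Lemma hall_assign N i : hall N ->
  exists2 y, y \in N i & hall (assign N i y).
Proof.
move=> hN; apply: contrapT => nex.
have tight1 y : y \in N i -> exists P, [/\ i \notin P,
    (#|` neighbours N P| <= #|` P|)%N & y \in neighbours N P].
  move=> yN; have /existsNP[Q /negP] : ~ hall (assign N i y).
    by move=> h; apply: nex; exists y.
  rewrite -ltnNge => ltQ; pose P := (Q `\ i)%fset.
  have iP : i \notin P by rewrite !inE eqxx.
  have NP : neighbours (assign N i y) P = neighbours N P.
    apply/fsetP => z; apply/neighboursP/neighboursP => -[k kP zN];
      exists k => //;
      move: zN; rewrite /assign; case: eqP => // ki; by rewrite -ki kP in iP.
  have iQ : i \in Q.
    apply: contraTT ltQ => iQ; rewrite -leqNgt.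
    have <- : P = Q by apply/mem_fsetD1.
    by rewrite NP; apply: hN.
  have QE : Q = (i |` P)%fset by rewrite fsetD1K.
  have NQ : neighbours (assign N i y) Q = (y |` neighbours N P)%fset.
    rewrite QE neighboursU NP; congr (_ `|` _)%fset.
    by rewrite /neighbours big_seq_fset1 /assign eqxx.
  move: ltQ; rewrite NQ {1}QE !cardfsU1 iP ltnS => leP.
  have yP : y \in neighbours N P.
    apply: contraTT leP => /= ->; rewrite -ltnNge.
    by have := hN P; lia.
  by exists P; split=> //; rewrite yP in leP.
have tight (s : seq J) : {subset s <= N i} -> exists P, [/\ i \notin P,
    (#|` neighbours N P| <= #|` P|)%N & {subset s <= neighbours N P}].
  elim: s => [_|y s IH sub]; first by exists fset0;
    split; rewrite // /neighbours big_seq_fset0 cardfs0.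
  have [|P [iP tP sP]] := IH.
    by move=> z zs; apply: sub; rewrite inE zs orbT.
  have [|Q [iQ tQ yQ]] := tight1 y; first by apply: sub; rewrite inE eqxx.
  exists (P `|` Q)%fset; split; first by rewrite inE negb_or iP.
    exact: hall_tightU.
  move=> z; rewrite neighboursU !inE => /orP[/eqP->|/sP->] //.
  by rewrite yQ orbT.
have [P [iP tP sP]] := tight (N i) (fun y yN => yN).
have := hN (i |` P)%fset.
have -> : neighbours N (i |` P)%fset = neighbours N P.
  rewrite neighboursU; apply/fsetUidPr/fsubsetP => z /neighboursP[k].
  by rewrite inE => /eqP -> /sP.
by rewrite cardfsU1 iP; move: tP; lia.
Qed.

(** Assigning the indices one after the other keeps Hall's condition at every
    stage; applied to pairs of already assigned indices, it gives
    injectivity. *)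
Theorem hall_marriage N : I -> countable [set: I] -> hall N ->
  exists2 f : I -> J, injective f & forall i, f i \in N i.
Proof.
move=> i0 /(countable_enumeration i0)[e [idx idxK]] hN.
pose R (A B : nat * {N' | hall N'}) := B.1 = A.1.+1 /\
  exists2 y, y \in sval A.2 (e A.1) & sval B.2 = assign (sval A.2) (e A.1) y.
have [|F [F0 FS]] := @dependent_choice _ R _ (0%N, exist _ N hN).
  move=> [n [N' hN']]; apply: cid => /=.
  have [y yN hy] := hall_assign (e n) hN'.
  by exists (n.+1, exist _ _ hy); split=> //; exists y.
have F1 n : (F n).1 = n by elim: n => [|n IH]; rewrite ?F0 // (FS n).1 IH.
pose M n := sval (F n).2.
have hM n : hall (M n) by exact: svalP (F n).2.
have MS n : exists2 y, y \in M n (e n) & M n.+1 = assign (M n) (e n) y.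
  by have [_] := FS n; rewrite F1.
have Msub n i : (M n i `<=` N i)%fset.
  elim: n => [|n IH]; first by rewrite /M F0.
  have [y yM ->] := MS n; rewrite /assign; case: eqP => // ie.
  by rewrite fsub1set (fsubsetP IH) // ie.
(* once assigned, an index keeps its value: assigning it a second time picks
   from a singleton *)
have stable i : exists y, forall n, (idx i < n)%N -> M n i = [fset y]%fset.
  have [y yM My] := MS (idx i); exists y; elim=> // n IH.
  rewrite ltnS leq_eqVlt; case/orP=> [/eqP <-|/IH Mn].
    by rewrite My /assign idxK eqxx.
  have [z zM ->] := MS n; rewrite /assign; case: eqP => // ie.
  by move: zM; rewrite -ie Mn inE => /eqP ->.
have [f fP] := choice stable.
exists f => [i j fij|i].
  apply: contrapT => /eqP nij.
  pose n := (maxn (idx i) (idx j)).+1.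
  have /= := hM n [fset i; j]%fset.
  rewrite cardfs2 nij neighboursU /neighbours !big_seq_fset1.
  by rewrite !fP ?ltnS ?leq_maxl ?leq_maxr // fij fsetUid cardfs1.
have := fP i (idx i).+1 (ltnSn _) => Mi.
by apply: (fsubsetP (Msub (idx i).+1 i)); rewrite Mi inE.
Qed.

End Hall.

(** * From invariant means to Følner sets *)

Section FiniteAdditivity.
Context {R : realType} {G : Type} (m : set G -> R).
Hypotheses (m_ge0 : forall E, (0 <= m E)%R) (m1 : m [set: G] = 1%R).
Hypothesis mU : forall E F, E `&` F = set0 -> m (E `|` F) = (m E + m F)%R.

Lemma mean0 : m set0 = 0%R.
Proof.
have := mU (set0I set0); rewrite setU0 => /eqP.
by rewrite -subr_eq0 opprD addrA subrr add0r oppr_eq0 => /eqP.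
Qed.

Lemma mean_le1 E : (m E <= 1)%R.
Proof. by rewrite -m1 -(setUv E) mU ?setICr // lerDl m_ge0. Qed.

Lemma mean_bigcup (D : finType) (A : D -> set G) : trivIset setT A ->
  (\sum_d m (A d))%R = m (\bigcup_d A d).
Proof.
move=> tA; suff H (s : seq D) : uniq s ->
    (\sum_(d <- s) m (A d))%R = m (\bigcup_(d in [set` s]) A d).
  rewrite (H _ (index_enum_uniq D)); congr (m (bigcup _ A)).
  by apply/seteqP; split=> // d _ /=; rewrite mem_index_enum.
elim: s => [_|d s IH /= /andP[ds us]].
  by rewrite big_nil set_nil bigcup_set0 mean0.
rewrite big_cons IH //.
have -> : [set` d :: s] = d |` [set` s].
  apply/seteqP; split=> x /=; first by rewrite inE => /orP[/eqP|]; [left|right].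
  by rewrite inE => -[->|->]; rewrite ?eqxx ?orbT.
rewrite bigcup_setU1 mU //.
rewrite setI_bigcupr bigcup0 // => d' /= d's.
apply: contrapT => /eqP/set0P h; have := tA d d' I I h => dd'.
by rewrite dd' d's in ds.
Qed.

End FiniteAdditivity.

Section Folner.
Context {G : groupType}.
Implicit Types (C F : {fset G}).

Definition mulfs F C : {fset G} := [fset (g * c)%g | g in F, c in C]%fset.

Lemma mulfsP F C h :
  reflect (exists g c, [/\ g \in F, c \in C & h = (g * c)%g]) (h \in mulfs F C).
Proof.
apply: (iffP (imfset2P _ _ _ _ _)) => [[g gF [c cC ->]]|[g [c [gF cC ->]]]].
  by exists g, c.
by exists g => //; exists c.
Qed.

Lemma card_fsetM (K K' : choiceType) (P : {fset K}) (Q : {fset K'}) :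
  #|` (P `*` Q)%fset| = (#|` P| * #|` Q|)%N.
Proof.
rewrite (perm_size (enum_imfset2 _ _)) /= ?size_allpairs //.
by move=> [a b] [c d] _ _ /= [-> ->].
Qed.

Lemma card_fset_ord n : #|` [fset i | i in 'I_n]%fset| = n.
Proof. by rewrite card_imfset //= -cardE card_ord. Qed.

(** An injection moving points by right multiplication with elements of a
    finite set is piecewise a right translation, with finitely many pieces, so
    it preserves a right-invariant mean: no such injection goes from [q]
    copies of [G] to fewer copies. *)
Lemma mean_bounded_injection (R : realType) (m : set G -> R) C p q
    (f : G * 'I_q -> G * 'I_p) :
  invariant_mean m -> injective f ->
  (forall u, exists2 c, c \in C & (f u).1 = (u.1 * c)%g) -> (q <= p)%N.
Proof.
move=> [m_ge0 m1 mU mL] injf fC.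
(* the mean of the inverses is a right-invariant mean *)
pose m' (E : set G) := m [set x | E x^-1%g].
have m'_ge0 E : (0 <= m' E)%R by exact: m_ge0.
have m'1 : m' setT = 1%R by rewrite -m1; congr m; apply/seteqP.
have m'U (E E' : set G) :
    E `&` E' = set0 -> m' (E `|` E') = (m' E + m' E')%R.
  move=> EE'; rewrite /m' -mU //; apply/seteqP; split=> // x [/= Ex Fx].
  by have : (E `&` E') x^-1%g by []; rewrite EE'.
have m'R E c : m' [set (g * c)%g | g in E] = m' E.
  rewrite /m' -(mL c^-1%g [set x | E x^-1%g]); congr m.
  apply/seteqP; split=> x /=.
    move=> [g Eg gx]; exists g^-1%g; first by rewrite invgK.
    by rewrite -[x]invgK -gx invgM.
  move=> [y Ey <-]; exists y^-1%g => //.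
  by rewrite invgM invgK.
pose A i (d : 'I_p * C) := [set g | f (g, i) = ((g * val d.2)%g, d.1)].
have sum_i i : (\sum_d m' (A i d) = 1)%R.
  rewrite (mean_bigcup m'U) => [|[j c] [j' c'] _ _ [g []]] /=.
    rewrite -m'1; congr m'; apply/seteqP; split=> // g _.
    have [c cC fg] := fC (g, i).
    exists ((f (g, i)).2, [` cC]%fset) => //=.
    by rewrite /A /= -fg; case: (f _).
  by rewrite /A /= => -> [/mulgI/val_inj -> ->].
have sum_j j : (\sum_(d : 'I_q * C) m' (A d.1 (j, d.2)) <= 1)%R.
  under eq_bigr => d _ do rewrite -(m'R _ (val d.2)).
  rewrite (mean_bigcup m'U) => [|[i c] [i' c'] _ _ [g []]] /=.
    exact: (mean_le1 m'_ge0 m'1 m'U).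
  move=> [h fh hg] [h' fh' h'g].
  have [] : (h, i) = (h', i') by apply: injf; rewrite fh fh' /= hg h'g.
  move=> hh' ->; congr (_, _); apply: val_inj.
  by apply: (@mulgI _ h); rewrite hg {1}hh' h'g.
rewrite -(ler_nat R).
have -> : (q%:R = \sum_(i < q) \sum_d m' (A i d))%R.
  by under eq_bigr => i _ do rewrite sum_i; rewrite sumr_const card_ord.
have -> : (p%:R = \sum_(j < p) 1 :> R)%R by rewrite sumr_const card_ord.
apply: le_trans; last by apply: ler_sum => j _; exact: sum_j.
rewrite le_eqVlt; apply/orP; left; apply/eqP.
under eq_bigr => i _ do rewrite -(pair_bigA _ (fun j c => m' (A i (j, c)))) /=.
rewrite exchange_big; apply: eq_bigr => j _.
by rewrite -(pair_bigA _ (fun i c => m' (A i (j, c)))).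
Qed.

(** Følner's condition: for [p > 0], the set [F C] has fewer than [1 + 1 / p]
    times as many elements as [F].  Were the conclusion false, Hall's
    condition would hold for the relation between [p.+1] and [p] copies of [G]
    given by right multiplication with [C], and the resulting injection is
    excluded by the mean. *)
Theorem amenable_folner (R : realType) C p :
  countable [set: G] -> amenable R G ->
  exists F, (p * #|` mulfs F C| < p.+1 * #|` F|)%N.
Proof.
move=> cG [m mean_m]; apply: contrapT => /forallNP noF.
pose I := (G * 'I_p.+1)%type; pose J := (G * 'I_p)%type.
pose N (u : I) : {fset J} := (mulfs [fset u.1] C `*` [fset j | j in 'I_p])%fset.
have hN : hall N.
  move=> P; pose F := [fset u.1 | u in P]%fset.
  have subP : (P `<=` F `*` [fset i | i in 'I_p.+1])%fset.
    apply/fsubsetP => u uP; rewrite inE in_imfset //=.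
    by apply/imfsetP; exists u.2.
  apply: leq_trans (fsubset_leq_card subP) _.
  rewrite card_fsetM card_fset_ord mulnC.
  apply: (@leq_trans (p * #|` mulfs F C|)).
    by rewrite leqNgt; apply/negP/noF.
  rewrite mulnC -[X in (_ * X)%N](card_fset_ord p) -card_fsetM.
  apply: fsubset_leq_card; apply/fsubsetP => -[h j]; rewrite inE /=.
  case/andP=> /mulfsP[_ [c [/imfsetP[u /= uP ->] cC ->]]] jp.
  apply/neighboursP; exists u => //; rewrite inE /= jp andbT.
  by apply/mulfsP; exists u.1, c; rewrite inE.
have [f injf fN] : exists2 f : I -> J, injective f & forall i, f i \in N i.
  apply: hall_marriage => //; first exact: (1%g, ord0).
  by rewrite -setXTT; apply: countableX => //; exact: countableP.
suff : (p.+1 <= p)%N by rewrite ltnn.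
apply: (mean_bounded_injection mean_m injf (C := C)) => u.
have := fN u; rewrite inE => /andP[/mulfsP[g [c [+ cC ->]]] _].
by rewrite inE => /eqP ->; exists c.
Qed.

End Folner.

(** * Linear compactness *)

Section LinearCompactness.
Local Open Scope ring_scope.

Definition submodule (K : fieldType) (W : lmodType K) (P : set W) :=
  P 0 /\ forall a u v, P u -> P v -> P (a *: u + v).

Definition affine (K : fieldType) (W : lmodType K) (P : set W) :=
  forall a x y z, P x -> P y -> P z -> P (a *: (x - y) + z).

Lemma submodule_vspace (K : fieldType) (E : vectType K) (P : set E) :
  submodule P -> exists U : {vspace E}, forall v, v \in U <-> P v.
Proof.
move=> [P0 Plin].
suff H k (U : {vspace E}) : (dim E <= \dim U + k)%N -> {in U, forall v, P v} ->
    exists U' : {vspace E}, forall v, v \in U' <-> P v.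
  apply: (H (dim E) 0%VS); first by rewrite dimv0.
  by move=> v; rewrite memv0 => /eqP ->.
elim: k U => [|k IH] U dU UP.
  exists U => v; split=> [/UP //|_].
  suff -> : U = fullv by rewrite memvf.
  by apply/eqP; rewrite eqEdim subvf dimvf; move: dU; rewrite addn0.
have [PU|/existsNP[v /not_implyP[Pv /negP vU]]] :=
    pselect (forall v, P v -> v \in U).
  by exists U => v; split=> [/UP|/PU].
apply: (IH (<[v]> + U)%VS).
  apply: (leq_trans dU); rewrite addnS -addSn leq_add2r ltn_neqAle.
  rewrite dimvS ?addvSr // andbT; apply: contra vU => /eqP dUv.
  have /eqP -> : U == (<[v]> + U)%VS by rewrite eqEdim addvSr dUv leqnn.
  by rewrite -{1}[v]addr0 memv_add ?memv_line ?mem0v.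
move=> _ /memv_addP[_ /vlineP[a ->] [w wU ->]].
by apply: Plin => //; exact: UP.
Qed.

(** A decreasing sequence of affine subspaces of a finite-dimensional space is
    stationary, because the dimensions of the spaces of directions are. *)
Lemma affine_bigcap (K : fieldType) (E : vectType K) (A : nat -> set E) :
  (forall n, affine (A n)) -> (forall n, A n.+1 `<=` A n) ->
  (forall n, A n !=set0) -> exists v, forall n, A n v.
Proof.
move=> affA decA neA.
have mono n m : (n <= m)%N -> A m `<=` A n.
  by move=> /subnK <-; elim: (m - n)%N => // k IH x /decA /IH.
have /choice[U UP] n : exists U : {vspace E}, forall w,
    w \in U <-> exists x y, [/\ A n x, A n y & w = x - y].
  apply: submodule_vspace; split.
    by have [x Ax] := neA n; exists x, x; rewrite subrr.
  move=> a _ _ [x [y [Ax Ay ->]]] [x' [y' [Ax' Ay' ->]]].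
  by exists (a *: (x - y) + x'), y'; rewrite addrA; split=> //; apply: affA.
have Umono n m : (n <= m)%N -> (U m <= U n)%VS.
  move=> /mono nm; apply/subvP => w /UP[x [y [/nm Ax /nm Ay ->]]].
  by apply/UP; exists x, y.
have exd : exists d, `[< exists n, \dim (U n) = d >].
  by exists (\dim (U 0%N)); apply/asboolP; exists 0%N.
case: (ex_minnP exd) => d /asboolP[n dn] dmin.
have [v Av] := neA n; exists v => m.
have [/mono mn|/ltnW nm] := leqP m n; first exact: mn.
have [w Aw] := neA m.
have UE : U m = U n.
  apply/eqP; rewrite eqEdim Umono // dn dmin //.
  by apply/asboolP; exists m.
have : v - w \in U m.
  by rewrite UE; apply/UP; exists v, w; split=> //; exact: mono Aw.
move=> /UP[x [y [Ax Ay vw]]].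
by rewrite -(subrK w v) vw -(scale1r (x - y)); exact: affA.
Qed.

(** Linear compactness of [G -> V]: the coordinates of the limit are chosen
    one after the other, each choice being possible by [affine_bigcap] applied
    to the sets of values at the next point of an enumeration of [G]. *)
Lemma affine_compactness (G : choiceType) (K : fieldType) (V : vectType K)
    (L : nat -> set (G -> V)) : G -> countable [set: G] ->
  (forall n, affine (L n)) -> (forall n, L n.+1 `<=` L n) ->
  (forall n, L n !=set0) ->
  exists x, forall n (s : seq G), exists2 y, L n y & {in s, y =1 x}.
Proof.
move=> g0 /(countable_enumeration g0)[e [idx idxK]] affL decL neL.
pose good (M : nat -> set (G -> V)) := [/\ forall n, affine (M n),
  forall n, M n.+1 `<=` M n & forall n, M n !=set0].
pose cut (M : nat -> set (G -> V)) g v n := M n `&` [set y | y g = v].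
have good_cut M g : good M -> exists v, good (cut M g v).
  move=> [affM decM neM].
  have [|||v vP] := @affine_bigcap _ _ (fun n => [set y g | y in M n]).
  - move=> n a _ _ _ [x Mx <-] [y My <-] [z Mz <-].
    by exists (a *: (x - y) + z) => //; exact: affM.
  - by move=> n _ [x Mx <-]; exists x => //; exact: decM.
  - by move=> n; have [x Mx] := neM n; exists (x g), x.
  exists v; split=> [n a x y z [Mx xv] [My yv] [Mz zv]|n x [Mx xv]|n].
  - split; first exact: affM.
    rewrite /= in xv yv zv *.
    by rewrite -[LHS]/(a *: (x g - y g) + z g) xv yv zv subrr scaler0 add0r.
  - by split=> //; exact: decM.
  - by have [x Mx xv] := vP n; exists x.
pose R (A B : nat * {M | good M}) := B.1 = A.1.+1 /\
  exists v, sval B.2 = cut (sval A.2) (e A.1) v.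
have [|F [F0 FS]] := @dependent_choice _ R _
    (0%N, exist good L (And3 affL decL neL)).
  move=> [n [M gM]]; apply: cid => /=.
  have [v gv] := good_cut M (e n) gM.
  by exists (n.+1, exist _ _ gv); split=> //; exists v.
have F1 n : (F n).1 = n by elim: n => [|n IH]; rewrite ?F0 // (FS n).1 IH.
pose M k := sval (F k).2.
have /choice[v MS] k : exists v, M k.+1 = cut (M k) (e k) v.
  by have [_] := FS k; rewrite F1.
have MP k n y : M k n y -> L n y /\ forall i, (i < k)%N -> y (e i) = v i.
  elim: k => [|k IH]; first by rewrite /M F0.
  rewrite MS => -[/IH[Ly yv] yk]; split=> // i.
  by rewrite ltnS leq_eqVlt => /orP[/eqP ->|/yv].
exists (v \o idx) => n s.
pose k := \max_(g <- s) (idx g).+1.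
have [_ _ /(_ n)[y /MP[Ly yv]]] : good (M k) by exact: (svalP (F k).2).
exists y => // g gs /=; rewrite -[in LHS](idxK g); apply: yv.
exact: (@leq_bigmax_seq _ s xpredT (fun h => (idx h).+1)).
Qed.

End LinearCompactness.

Lemma prodiscrete_closed_approx (G : groupType) (A : choiceType)
    (X : set (G -> A)) (x : G -> A) : countable [set: G] ->
  prodiscrete_closed X ->
  (forall s : seq G, exists2 y, X y & {in s, y =1 x}) -> X x.
Proof.
move=> /(countable_enumeration 1%g)[e [idx idxK]] cX approx.
have /choice[u uP] n : exists y, X y /\ {in [seq e i | i <- iota 0 n], y =1 x}.
  by have [y Xy yx] := approx [seq e i | i <- iota 0 n]; exists y.
pose u' : nat -> {ptws G -> discrete_topology A} := u.
apply: (@closed_cvg _ _ \oo _ u' X cX _ x).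
  by apply: nearW => n; have [] := uP n.
apply/cvg_sup => g U [W [[W' oW <-] Wx WU]].
apply: (filterS WU); exists (idx g).+1 => // n /= gn.
have [_ unx] := uP n.
suff -> : W' (u' n g) = W' (x g) by [].
congr W'; apply: unx; apply/mapP; exists (idx g); rewrite ?idxK //.
by rewrite mem_iota.
Qed.

(** * Configurations with finite support *)

Section FiniteSupport.
Local Open Scope ring_scope.
Context {G : choiceType} {K : fieldType} {V : vectType K}.
Implicit Types (F : {fset G}) (x : G -> V).

Definition supported F x := forall g, g \notin F -> x g = 0.

Definition extend F (f : {ffun F -> V}) : G -> V :=
  fun g => if insub g is Some i then f i else 0.

Definition restrict F x : {ffun F -> V} := [ffun i => x (val i)].

Lemma extend_supported F f : supported F (@extend F f).
Proof. by move=> g gF; rewrite /extend insubN. Qed.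

Lemma extendK F : cancel (@extend F) (@restrict F).
Proof. by move=> f; apply/ffunP => i; rewrite ffunE /extend valK. Qed.

Lemma restrictK F x : supported F x -> extend (restrict F x) = x.
Proof.
move=> Fx; apply/funext => g; rewrite /extend.
by case: insubP => [i _ <-|/Fx ->]; rewrite ?ffunE.
Qed.

Lemma extend_linear F : linear (@extend F).
Proof.
move=> a f f'; apply/funext => g.
rewrite -[RHS]/(a *: extend f g + extend f' g) /extend.
by case: insub => [i|]; rewrite ?ffunE // scaler0 addr0.
Qed.

Lemma restrict_linear F : linear (@restrict F).
Proof. by move=> a x y; apply/ffunP => i; rewrite !ffunE. Qed.

Lemma linear_hom (aT rT : vectType K) (f : aT -> rT) : linear f ->
  exists h : 'Hom(aT, rT), h =1 f.
Proof.
move=> linf.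
pose ff : {linear aT -> rT} :=
  HB.pack f (GRing.isLinear.Build K aT rT _ f linf).
by exists (linfun ff) => v; rewrite lfunE.
Qed.

(** Write [X_F] for the space of configurations of [X] supported in [F].  An
    injective linear [tau] embeds [X_F] in [X_F']; if the [w t] are linearly
    independent modulo the image of [tau], this gives
    [\dim X_F + #|T| <= \dim X_F'].  Restriction to the complement of [F] in
    [F'] has kernel [X_F], which bounds [\dim X_F'] from above. *)
Lemma card_independent_le (X : set (G -> V)) (tau : (G -> V) -> (G -> V))
    F F' (T : finType) (w : T -> G -> V) :
  submodule X -> (F `<=` F')%fset ->
  (forall a x y, X x -> X y -> tau (a *: x + y) = a *: tau x + tau y) ->
  (forall x, X x -> supported F x -> X (tau x) /\ supported F' (tau x)) ->
  (forall x, X x -> tau x = 0 -> x = 0) ->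
  (forall t, X (w t) /\ supported F' (w t)) ->
  (forall (c : T -> K) x, X x -> tau x = \sum_t c t *: w t ->
     forall t, c t = 0) ->
  (#|T| <= #|` (F' `\` F)%fset| * dim V)%N.
Proof.
move=> [X0 Xlin] FF' tau_lin tau_supp tau_inj Xw indep.
pose E := {ffun F' -> V}; pose D := (F' `\` F)%fset.
have ext0 : extend (0 : E) = 0.
  by apply/funext => g; rewrite /extend; case: insub => // i; rewrite ffunE.
have ext_inj : injective (@extend F') by exact: can_inj (@extendK F').
have [|U' U'P] := @submodule_vspace K E [set f | X (extend f)].
  by split=> /= [|a f f' Xf Xf']; rewrite ?ext0 // extend_linear; apply: Xlin.
have [|rho rhoE] := @linear_hom E {ffun D -> V}
    (fun f => restrict D (extend f)).
  by move=> a f f'; rewrite extend_linear restrict_linear.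
pose U := (U' :&: lker rho)%VS.
have UP f : f \in U <-> X (extend f) /\ supported F (extend f).
  rewrite memv_cap memv_ker rhoE; split.
    case/andP => /U'P Xf /eqP rf; split=> // g gF.
    have [gF'|/extend_supported //] := boolP (g \in F').
    have gD : g \in D by rewrite inE gF gF'.
    by have /ffunP/(_ [` gD]%fset) := rf; rewrite !ffunE.
  move=> [/U'P -> Ff] /=; apply/eqP/ffunP => i; rewrite !ffunE; apply: Ff.
  by have := valP i; rewrite inE => /andP[].
have dimU' : (\dim U' <= \dim U + #|` D| * dim V)%N.
  rewrite -(limg_ker_dim rho U') leq_add2l.
  apply: leq_trans (dimvS (subvf _)) _.
  by rewrite dimvf /dim /= cardfE.
have [|t tE] := @linear_hom E E
    (fun f => restrict F' (tau (extend (projv U f)))).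
  move=> a f f'; rewrite linearP extend_linear tau_lin ?restrict_linear //.
    by have /UP[] := memv_proj U f.
  by have /UP[] := memv_proj U f'.
have ext_t f : f \in U -> extend (t f) = tau (extend f).
  move=> fU; rewrite tE projv_id // restrictK //.
  by have /UP[Xf /(tau_supp _ Xf)[]] := fU.
pose sw (c : {ffun T -> K^o}) : G -> V := \sum_i c i *: w i.
have swE c g : sw c g = \sum_i c i *: w i g by rewrite /sw fct_sumE.
have [|psi psiE] := @linear_hom {ffun T -> K^o} E (fun c => restrict F' (sw c)).
  move=> a c c'; rewrite -restrict_linear; congr restrict.
  rewrite /sw scaler_sumr -big_split; apply: eq_bigr => i _ /=.
  by rewrite !ffunE scalerDl scalerA.
have ext_psi c : extend (psi c) = sw c.
  rewrite psiE restrictK // => g gF'; rewrite swE big1 // => i _.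
  by rewrite (Xw i).2 // scaler0.
have sw_tau c x : X x -> tau x = sw c -> c = 0.
  by move=> Xx /(indep _ _ Xx) c0; apply/ffunP => i; rewrite ffunE.
have tau0 : tau 0 = 0.
  by have := tau_lin (-1) 0 0 X0 X0; rewrite scaler0 addr0 scaleN1r addNr.
have dim_t : \dim (t @: U) = \dim U.
  apply: limg_dim_eq; apply/eqP; rewrite -subv0; apply/subvP => f.
  rewrite memv_cap memv_ker memv0 => /andP[fU /eqP tf].
  have /UP[Xf _] := fU; apply/eqP/ext_inj; rewrite ext0.
  by apply: tau_inj => //; rewrite -ext_t // tf ext0.
have dim_psi : \dim (limg psi) = #|T|.
  rewrite limg_dim_eq; first by rewrite dimvf /dim /= muln1.
  apply/eqP; rewrite capfv -subv0; apply/subvP => c.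
  rewrite memv_ker memv0 => /eqP pc; apply/eqP/(sw_tau _ 0) => //.
  by rewrite tau0 -ext_psi pc ext0.
have disj : (t @: U :&: limg psi = 0)%VS.
  apply/eqP; rewrite -subv0; apply/subvP => v; rewrite memv_cap.
  case/andP=> /memv_imgP[f fU ->] /memv_imgP[c _ tf].
  have /UP[Xf _] := fU.
  rewrite memv0 tf (sw_tau c (extend f)) ?linear0 //.
  by rewrite -ext_psi -tf ext_t.
have sub : (t @: U + limg psi <= U')%VS.
  rewrite subv_add; apply/andP; split; apply/subvP => v /memv_imgP[].
    move=> f fU ->; apply/U'P; rewrite /= ext_t //.
    by have /UP[Xf /(tau_supp _ Xf)[]] := fU.
  move=> c _ ->; apply/U'P; rewrite /= ext_psi /sw.
  elim/big_ind: _ => // [x y Xx Xy|i _].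
    by rewrite -(scale1r x); apply: Xlin.
  by rewrite -[c i *: _]addr0; apply: Xlin => //; exact: (Xw i).1.
have := dimvS sub; rewrite dimv_disjoint_sum // dim_t dim_psi.
by move=> /leq_trans/(_ dimU'); rewrite leq_add2l.
Qed.

End FiniteSupport.

(** * Linear subshifts and linear cellular automata *)

Section Subshifts.
Local Open Scope ring_scope.
Context {G : groupType} {K : fieldType} {V : vectType K}.
Implicit Types (X : set (G -> V)) (tau : (G -> V) -> (G -> V)).

Lemma linear_subshift_submodule X : linear_subshift X -> submodule X.
Proof.
move=> [_ [X0 Xlin]]; split; first by have := X0; rewrite inE.
by move=> a u v Xu Xv; have := Xlin a u v; rewrite !inE; apply.
Qed.

Lemma linear_cellular_automaton0 X tau :
  submodule X -> linear_cellular_automaton X X tau -> tau 0 = 0.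
Proof.
move=> [X0 _] [_ linT]; have := linT (-1) 0 0; rewrite !inE => /(_ X0 X0).
by rewrite scaler0 addr0 scaleN1r addNr.
Qed.

Lemma subshift_shift X g x : subshift X -> X x -> X (Defs.shift g x).
Proof. by move=> [_ inv] Xx; apply: (inv g); exists x. Qed.

Lemma cellular_automaton_local X tau : cellular_automaton X X tau ->
  exists s : seq G, forall x x' g, X x -> X x' ->
    {in s, forall m, x (g * m)%g = x' (g * m)%g} -> tau x g = tau x' g.
Proof.
move=> [_ [M /finite_seqP[s ->]] [mu muE]].
exists s => x x' g Xx Xx' xx'; rewrite !muE //; congr mu.
apply/funext => -[m ms]; rewrite /sigL /= /Defs.shift invgK.
exact: xx' (set_mem ms).
Qed.

Lemma cellular_automaton_shift X tau g x : subshift X ->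
  cellular_automaton X X tau -> X x ->
  tau (Defs.shift g x) = Defs.shift g (tau x).
Proof.
move=> sX [_ [M _ [mu muE]]] Xx; apply/funext => h.
rewrite [in RHS]/Defs.shift !muE //; last exact: subshift_shift.
congr mu; apply/funext => m; rewrite /sigL /= /Defs.shift; congr x.
by rewrite !invgK mulgA.
Qed.

(** A family of affine conditions, one for each [g], each depending on finitely
    many coordinates, can be met in a closed [X] as soon as its finite
    subfamilies can: [X] behaves as a compact space. *)
Lemma local_conditions_compactness X (Phi : G -> set (G -> V)) :
  countable [set: G] -> prodiscrete_closed X ->
  (forall g, affine (X `&` Phi g)) ->
  (forall g, exists s : seq G, forall x x', X x -> X x' ->
     {in s, x =1 x'} -> Phi g x -> Phi g x') ->
  (forall s : seq G, exists2 x, X x & {in s, forall g, Phi g x}) ->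
  exists2 x, X x & forall g, Phi g x.
Proof.
move=> cG cX affPhi locPhi finPhi.
have [e [idx idxK]] := countable_enumeration 1%g cG.
(* with [i <= n], not [i < n], as the condition at [e 0] makes [L 0] affine *)
pose L n := [set x | X x /\ forall i, (i <= n)%N -> Phi (e i) x].
have [|||x xP] := @affine_compactness G K V L 1%g cG.
- move=> n a u v w [Xu Pu] [Xv Pv] [Xw Pw].
  have H i : (i <= n)%N -> (X `&` Phi (e i)) (a *: (u - v) + w).
    by move=> lein; apply: affPhi; split=> //; [exact: Pu|exact: Pv|exact: Pw].
  by split=> [|i /H[]//]; have [] := H 0%N isT.
- by move=> n x [Xx Px]; split=> // i lein; apply: Px; apply: leqW.
- move=> n; have [x Xx Px] := finPhi [seq e i | i <- iota 0 n.+1].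
  exists x; split=> // i lein; apply: Px.
  by apply/mapP; exists i; rewrite // mem_iota.
have Xx : X x.
  apply: prodiscrete_closed_approx => // t.
  by have [y [Xy _] yx] := xP 0%N t; exists y.
exists x => // g; have [t tP] := locPhi g.
have [y [Xy Py] yx] := xP (idx g) t.
by apply: (tP y) => //; rewrite -(idxK g); exact: Py.
Qed.

Lemma linear_cellular_automaton_image_closed X tau y :
  countable [set: G] -> linear_subshift X ->
  linear_cellular_automaton X X tau ->
  (forall s : seq G, exists2 x, X x & {in s, tau x =1 y}) ->
  exists2 x, X x & tau x = y.
Proof.
move=> cG lX [caT linT] approx; have [[cX _] _] := lX.
have [X0 Xlin] := linear_subshift_submodule lX.
have [t tP] := cellular_automaton_local caT.
have [|||x Xx xy] := @local_conditions_compactness X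
    (fun g => [set x | tau x g = y g]) cG cX.
- move=> g a u v w [Xu uy] [Xv vy] [Xw wy].
  have Xuv : X (u - v) by rewrite addrC -scaleN1r; exact: Xlin.
  split; first exact: Xlin.
  rewrite /= linT ?inE // -[u - v]addrC -scaleN1r linT ?inE //.
  rewrite -[LHS]/(a *: (-1 *: tau v g + tau u g) + tau w g).
  by rewrite /= in uy vy wy; rewrite uy vy wy scaleN1r addNr scaler0 add0r.
- move=> g; exists [seq (g * m)%g | m <- t] => u v Xu Xv uv /= <-.
  by apply: tP => // m mt; rewrite uv //; apply/mapP; exists m.
- exact: approx.
by exists x => //; apply/funext.
Qed.

(** Strong irreducibility only provides, for each finite part of the
    complement of a large finite set, a configuration vanishing on that part;
    compactness yields one vanishing on the whole complement. *)
Lemma strongly_irreducible_finite_support X y (s : seq G) :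
  countable [set: G] -> linear_subshift X -> strongly_irreducible X -> X y ->
  exists z (S : {fset G}), [/\ X z, supported S z & {in s, z =1 y}].
Proof.
move=> cG lX [Delta /finite_seqP[d ->] irr] Xy.
have [[cX _] _] := lX; have [X0 Xlin] := linear_subshift_submodule lX.
pose S : {fset G} := [fset h in s ++ [seq (h * k^-1)%g | h <- s, k <- d]]%fset.
have [|||z Xz zP] := @local_conditions_compactness X
    (fun g => [set z | (g \in s -> z g = y g) /\ (g \notin S -> z g = 0)])
    cG cX.
- move=> g a u v w [Xu [us uS]] [Xv [vs vS]] [Xw [ws wS]]; split.
    by apply: (Xlin) => //; rewrite addrC -scaleN1r; exact: Xlin.
  split=> gP; rewrite -[LHS]/(a *: (u g - v g) + w g).
    by rewrite us // vs // ws // subrr scaler0 add0r.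
  by rewrite uS // vS // wS // subrr scaler0 add0r.
- move=> g; exists [:: g] => u v _ _ uv [us uS].
  by split=> gP; rewrite -uv ?inE //; [apply: us|apply: uS].
- move=> t.
  have [|z [Xz z1 z2]] := irr [set` s] [set` [seq g <- t | g \notin S]]
      (finite_seq _) (finite_seq _) _ y 0 Xy X0.
    move=> [g /=]; rewrite mem_filter => /andP[gS _] [_ [[k /= kd <-] /= gks]].
    case/negP: gS; rewrite !inE; apply/orP; right.
    by apply/allpairsP; exists ((g * k)%g, k); rewrite /= mulgK.
  exists z => // g gt; split=> gP; first by apply: z1; rewrite inE.
  by apply: z2; rewrite inE /= mem_filter gP.
exists z, S; split=> // g; [exact: (zP g).2|exact: (zP g).1].
Qed.

(** Greedy choice: picking [f] excludes only the elements of [f S S^-1], of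
    which there are at most the square of the cardinal of [S]. *)
Lemma disjoint_translates (S F : {fset G}) : S != fset0 ->
  exists T : {fset G}, [/\ (T `<=` F)%fset,
    {in T & T, forall g h, forall a b, a \in S -> b \in S ->
       (g * a)%g = (h * b)%g -> g = h} &
    (#|` F| <= #|` T| * (#|` S| * #|` S|))%N].
Proof.
move=> /fset0Pn[a0 a0S].
have [n] := ubnP #|` F|; elim: n F => // n IH F.
have [->|/fset0Pn[f fF]] := eqVneq F fset0.
  by exists fset0; split; rewrite ?cardfs0 // => g h; rewrite inE.
pose B := [fset (f * u.1 * u.2^-1)%g | u in S `*` S]%fset.
have fB : f \in B.
  by apply/imfsetP; exists (a0, a0); rewrite ?inE /= ?a0S ?mulgK.
have cardB : (#|` B| <= #|` S| * #|` S|)%N.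
  by rewrite -card_fsetM; exact: leq_imfset_card.
rewrite ltnS => Fn; have [|T [TF Tsep cardT]] := IH (F `\` B)%fset.
  have : (0 < #|` (F `&` B)%fset|)%N.
    by rewrite cardfs_gt0; apply/fset0Pn; exists f; rewrite inE fF.
  move=> lt0; apply: leq_trans Fn.
  by rewrite -[ltnRHS](cardfsID B F) -[ltnLHS]add0n ltn_add2r.
have TB g : g \in T -> g \notin B.
  by move=> /(fsubsetP TF); rewrite inE => /andP[].
have fsep h a b : h \in T -> a \in S -> b \in S -> (f * a)%g <> (h * b)%g.
  move=> hT aS bS fahb; have /negP := TB h hT; apply.
  by apply/imfsetP; exists (a, b); rewrite ?inE /= ?aS ?bS // fahb mulgK.
exists (f |` T)%fset; split.
- apply/fsubsetP => g; rewrite !inE => /orP[/eqP -> //|].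
  by move=> /(fsubsetP TF); rewrite inE => /andP[].
- move=> g h; rewrite !inE => /orP[/eqP ->|gT] /orP[/eqP ->|hT] a b aS bS //.
  + by move/(fsep _ _ _ hT aS bS).
  + by move/esym/(fsep _ _ _ gT bS aS).
  + exact: Tsep.
- have fT : f \notin T by apply/negP => /TB; rewrite fB.
  rewrite -(cardfsID B F) cardfsU1 fT mulnDl mul1n leq_add //.
  exact: leq_trans (fsubset_leq_card (fsubsetIr F B)) cardB.
Qed.

End Subshifts.

(** * Surjunctivity *)

Section Surjunctivity.
Local Open Scope ring_scope.
Context {G : groupType} {K : fieldType} {V : vectType K}.

(** Translates [g z], for [g] in a set [T] with disjoint translates [g S], are
    linearly independent modulo the image of [tau]: a combination in the image
    with nonzero coefficient at [g], translated back by [g^-1] and divided by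
    that coefficient, agrees with [z] on [s] because the other terms vanish
    there. *)
Lemma translates_independent (X : set (G -> V)) tau z (S T : {fset G})
    (s : seq G) :
  linear_subshift X -> linear_cellular_automaton X X tau ->
  supported S z -> {subset s <= S} ->
  (forall x, X x -> ~ {in s, tau x =1 z}) ->
  {in T & T, forall g h, forall a b, a \in S -> b \in S ->
     (g * a)%g = (h * b)%g -> g = h} ->
  forall (c : T -> K) x, X x ->
    tau x = \sum_t c t *: Defs.shift (val t) z -> forall t, c t = 0.
Proof.
move=> lX linCA Sz sS noz Tsep c x Xx tauE t.
apply: contrapT => /eqP ct.
have [caT linT] := linCA; have [sX _] := lX.
have Xsub := linear_subshift_submodule lX; have [X0 Xlin] := Xsub.
have tau0 := linear_cellular_automaton0 Xsub linCA.
(* after scaling, [y] is the element whose image would agree with [z] on [s] *)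
pose y := Defs.shift (val t)^-1%g x.
have Xy : X y by exact: subshift_shift.
apply: (noz ((c t)^-1 *: y)).
  by rewrite -[_ *: _]addr0; exact: Xlin.
move=> h hs.
have -> : tau ((c t)^-1 *: y) = (c t)^-1 *: tau y.
  by rewrite -[in LHS](addr0 (_ *: y)) linT ?inE // tau0 addr0.
rewrite (cellular_automaton_shift _ sX caT Xx) tauE.
rewrite -[LHS]/((c t)^-1 *: (\sum_u c u *: Defs.shift (val u) z)
  ((val t)^-1^-1 * h)%g) fct_sumE (bigD1 t) //= big1 => [|u ut].
  rewrite -[(c t *: _) _]/(c t *: z ((val t)^-1 * ((val t)^-1^-1 * h))%g).
  by rewrite invgK mulKg addr0 scalerA mulVf // scale1r.
rewrite -[LHS]/(c u *: z ((val u)^-1 * ((val t)^-1^-1 * h))%g) invgK.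
rewrite Sz ?scaler0 //; apply: contra ut => uth; apply/eqP/val_inj.
apply: (Tsep _ _ (valP u) (valP t) _ h uth (sS _ hs)).
by rewrite mulVKg.
Qed.

Lemma cellular_automaton_supported (X : set (G -> V))
    (tau : (G -> V) -> (G -> V)) (t : seq G)
    (F F' : {fset G}) (x : G -> V) :
  X 0 -> tau 0 = 0 ->
  (forall x x' g, X x -> X x' ->
     {in t, forall m, x (g * m)%g = x' (g * m)%g} -> tau x g = tau x' g) ->
  (forall g m, m \in t -> (g * m)%g \in F -> g \in F') ->
  X x -> supported F x -> supported F' (tau x).
Proof.
move=> X0 tau0 loc FF' Xx Fx g gF'.
rewrite (loc x 0 g Xx X0) ?tau0 // => m mt; rewrite Fx //.
by apply: contra gF'; exact: FF'.
Qed.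

End Surjunctivity.

Theorem theorem1p4 (R : realType) (G : groupType) (K : fieldType)
    (V : vectType K) (X : set (G -> V)) :
  countable [set: G] -> amenable R G ->
  linear_subshift X -> strongly_irreducible X ->
  L_surjunctive X.
Proof.
move=> cG aG lX irrX tau linCA injtau y Xy.
have [caT linT] := linCA; have [sX _] := lX.
have Xsub := linear_subshift_submodule lX; have [X0 Xlin] := Xsub.
have tau0 := linear_cellular_automaton0 Xsub linCA.
apply: contrapT => ny.
have [s noy] : exists s : seq G, forall x, X x -> ~ {in s, tau x =1 y}.
  apply: contrapT => /forallNP h; apply: ny.
  have [x Xx <-] : exists2 x, X x & tau x = y; last by exists x.
  apply: linear_cellular_automaton_image_closed cG lX linCA _ => s.
  by have /existsNP[x /not_implyP[Xx /contrapT xy]] := h s; exists x.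
have [z [S0 [Xz S0z zy]]] :=
  strongly_irreducible_finite_support s cG lX irrX Xy.
have noz x : X x -> ~ {in s, tau x =1 z}.
  by move=> Xx xz; apply: (noy x Xx) => g gs; rewrite xz // zy.
(* with 1 in [S] and in [B], the sets [F0], [F] and [F'] below are nested *)
pose S := (1%g |` (S0 `|` [fset g in s]))%fset.
have S1 : 1%g \in S by rewrite !inE eqxx.
have Sz : supported S z.
  by move=> g; rewrite !inE !negb_or => /and3P[_ /S0z].
have sS : {subset s <= S} by move=> g gs; rewrite !inE gs !orbT.
have [t tloc] := cellular_automaton_local caT.
pose B := (1%g |` [fset m^-1%g | m in t])%fset.
pose p := (#|` S| * #|` S| * dim V)%N.
have [F0 F0P] := @amenable_folner G R (mulfs S B) p cG aG.
have Sn0 : S != fset0 by apply/fset0Pn; exists 1%g.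
have [T [TF0 Tsep cardT]] := disjoint_translates F0 Sn0.
pose F := mulfs F0 S; pose F' := mulfs F0 (mulfs S B).
have FF' : (F `<=` F')%fset.
  apply/fsubsetP => _ /mulfsP[f [a [fF aS ->]]]; apply/mulfsP.
  exists f, a; split=> //; apply/mulfsP; exists a, 1%g.
  by split; rewrite ?mulg1 ?fset1U1.
have F0F : (#|` F0| <= #|` F|)%N.
  apply/fsubset_leq_card/fsubsetP => f fF.
  by apply/mulfsP; exists f, 1%g; rewrite mulg1.
have F'P g m : m \in t -> (g * m)%g \in F -> g \in F'.
  move=> mt /mulfsP[f [a [fF aS gm]]]; apply/mulfsP.
  exists f, (a * m^-1)%g; split=> //; last by rewrite mulgA -gm mulgK.
  apply/mulfsP; exists a, m^-1%g; split=> //.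
  by rewrite inE; apply/orP; right; apply/imfsetP; exists m.
have : (#|{: T}| <= #|` (F' `\` F)%fset| * dim V)%N.
  apply: (@card_independent_le _ _ _ X tau F F' _
    (fun u : T => Defs.shift (val u) z)) => //.
  - by move=> a x x' Xx Xx'; apply: linT; rewrite inE.
  - move=> x Xx Fx; split; first by have [[fT _] _] := linCA; exact: fT.
    exact: cellular_automaton_supported tloc F'P Xx Fx.
  - by move=> x Xx x0; apply: injtau; rewrite ?inE // tau0.
  - move=> u; split; first exact: subshift_shift.
    move=> g gF'; apply: Sz; apply: contra gF' => gS.
    apply/(fsubsetP FF')/mulfsP; exists (val u), ((val u)^-1 * g)%g.
    by rewrite mulVKg (fsubsetP TF0) ?(valP u).
  - exact: translates_independent Sz sS noz Tsep.
rewrite -cardfE cardfsDS // => leT.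
have F'F := fsubset_leq_card FF'.
move: F0P; rewrite ltnNge => /negP; apply.
rewrite -/F'.
have le1 : (#|` F0| <= p * (#|` F'| - #|` F|))%N.
  apply: leq_trans cardT _; rewrite mulnC /p -!mulnA leq_mul2l leq_mul2l.
  by rewrite [(dim V * _)%N]mulnC leT !orbT.
rewrite mulSn; apply: leq_trans (leq_add le1 (leq_mul (leqnn p) F0F)) _.
by rewrite -mulnDr subnK.
Qed.
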